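(* Let $a,b>0$ and let $h(t,x)=\frac{b^{at}}{\Gamma(at)}x^{at-1}e^{-bx}$, $t>0$, $x>0$, be the density of the gamma subordinator $H_t$ with Laplace exponent $\Phi(\lambda)=a\ln(1+\lambda/b)$. For $x\in(0,\infty)$, $$\int_0^\infty e^{-\lambda t}\,h(t,x)\,dt=e^{-bx}\,\frac{b}{a}\,e^{-\frac{\lambda}{a}}\,\nu\!\left(b\,x\,e^{-\frac{\lambda}{a}},-1\right),\qquad\lambda>0 .$$
   Context: For $\alpha\in\mathbb{R}$, $x>0$, $\nu(x,\alpha)=\int_0^\infty\frac{x^{\alpha+y}}{\Gamma(\alpha+y+1)}\,dy$ (with $1/\Gamma$ the entire reciprocal gamma function). The gamma subordinator $H$ satisfies $H_0=0$ and $\mathbf{E}_0[e^{-\lambda H_t}]=e^{-t\Phi(\lambda)}$ for $\lambda\ge0$. *)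

(* Defs.v *)
From HB Require Import structures.
From mathcomp Require Import all_boot all_order all_algebra.
From mathcomp Require Import all_classical all_reals all_analysis.

Set Implicit Arguments.
Unset Strict Implicit.
Unset Printing Implicit Defensive.

Import Order.TTheory GRing.Theory Num.Theory.
Import numFieldNormedType.Exports.

Local Open Scope classical_set_scope.
Local Open Scope ring_scope.

(* Euler's integral; only meaningful for 0 < z, where it converges. *)
Definition Gamma (R : realType) (z : R) : R :=
  \int[lebesgue_measure]_(s in `]0, +oo[) (s `^ (z - 1) * expR (- s)).

(* The restriction to the real line of the entire function 1/Gamma, by
   iterating 1/Gamma(z) = z/Gamma(z + 1): n is the least natural number such
   that 0 < z + n. In particular n = 0 and rgamma z = 1/Gamma(z) for 0 < z,
   and the product vanishes for z = 0, -1, -2, ... *)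
Definition rgamma (R : realType) (z : R) : R :=
  let n := Num.truncn (1 - z) in
  (\prod_(i < n) (z + i%:R)) / Gamma (z + n%:R).

(* The integral converges absolutely for every 0 < x and every alpha. *)
Definition nu (R : realType) (x alpha : R) : R :=
  \int[lebesgue_measure]_(y in `[0, +oo[)
    (x `^ (alpha + y) * rgamma (alpha + y + 1)).

Definition gamma_density (R : realType) (a b t x : R) : R :=
  b `^ (a * t) / Gamma (a * t) * x `^ (a * t - 1) * expR (- (b * x)).

Definition gamma_exponent (R : realType) (a b lam : R) : R :=
  a * ln (1 + lam / b).

Section subordinators.
Context {R : realType} {d : measure_display} {T : measurableType d}.
Variable P : probability T R.

(* Processes are indexed by R, but only times 0 <= t are constrained. *)
Implicit Type H : R -> {RV P >-> R}.

Definition increment H (s t : R) (w : T) : R := H t w - H s w.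

Definition independent_increments H : Prop :=
  forall (n : nat) (t : nat -> R) (A : nat -> set R),
    0 <= t 0%N ->
    (forall i, (i < n)%N -> t i <= t i.+1) ->
    (forall i, (i < n)%N -> measurable (A i)) ->
    P (\bigcap_(i in `I_n) (increment H (t i) (t i.+1) @^-1` A i)) =
    (\prod_(i < n) P (increment H (t i) (t i.+1) @^-1` A i))%E.

Definition stationary_increments H : Prop :=
  forall (s t : R) (A : set R), 0 <= s -> 0 <= t -> measurable A ->
    P (increment H s (s + t) @^-1` A) = P (increment H 0 t @^-1` A).

(* Left limits need not be required: they exist along nondecreasing paths. *)
Definition subordinator H : Prop :=
  [/\ {ae P, forall w, [/\ H 0 w = 0,
        forall s t : R, 0 <= s -> s <= t -> H s w <= H t w &
        forall t : R, 0 <= t -> (fun s : R => H s w) @ t^'+ --> H t w]},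
      independent_increments H &
      stationary_increments H].

Definition laplace_exponent H (Phi : R -> R) : Prop :=
  forall t lam : R, 0 <= t -> 0 <= lam ->
    ('E_P[fun w => expR (- (lam * H t w))] = (expR (- (t * Phi lam)))%:E)%E.

(* f is a density on the half-line x > 0 (its values at x <= 0 are ignored). *)
Definition has_density (X : {RV P >-> R}) (f : R -> R) : Prop :=
  forall A : set R, measurable A ->
    P (X @^-1` A) =
    (\int[lebesgue_measure]_(x in A `&` `]0%R, +oo[) (f x)%:E)%E.

End subordinators.

(* Main.v *)
(* For the time integral, substitute y = a t: the integrand becomes a constant
   times z^(y-1) / Gamma(y) with z = b x exp(-lambda / a), whose integral is
   nu(z, -1); it converges because Gamma(y) >= c M^y for every M > 0.

   That h(t, .) is the density of H_t follows from uniqueness of the Laplace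
   transform. For X >= 0, expanding the binomial shows that
   E[(1 - exp(-n X))^m] depends only on the Laplace transform of X. With
   m ~ n exp(n c) the integrand tends to the indicator of X > c as n grows, and
   dominated convergence recovers all the tails P(X > c). *)

Require Import Defs.
From HB Require Import structures.
From mathcomp Require Import all_boot all_order all_algebra.
From mathcomp Require Import all_classical all_reals all_analysis.
From mathcomp Require Import measurable_realfun ring lra.

Import Order.TTheory GRing.Theory Num.Theory.
Import numFieldNormedType.Exports.

Local Open Scope classical_set_scope.
Local Open Scope ring_scope.

(** * Linear change of variables on the half-line *)

(** The right side is a measure in [A] that gives []u, v]] its length, the preimage being []u / k, v
    / k]]; uniqueness of Lebesgue measure concludes. *)
Lemma lebesgue_measure_scale (R : realType) (k : R) (A : set R) :
  0 < k -> measurable A ->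
  lebesgue_measure A =
  (k%:E * lebesgue_measure ((fun x => k * x)%R @^-1` A))%E.
Proof.
move=> k0 mA; pose f : measurableTypeR R -> measurableTypeR R := fun x => k * x.
have mf : measurable_fun setT f by exact: measurable_funM.
pose kn : {nonneg R} := NngNum (ltW k0).
pose m := mscale kn (pushforward (@lebesgue_measure R) f).
rewrite (@lebesgue_measure_unique R (m mf))// => _ [[u v]] _ <-.
change (lebesgue_measure `]u, v] = k%:E * lebesgue_measure (f @^-1` `]u, v]))%E.
have -> : f @^-1` [set` `]u, v]] = `]u / k, v / k]%classic.
  by apply/seteqP; split=> x/=; rewrite !in_itv/= ltr_pdivrMr// ler_pdivlMr// /f
    [k * x]mulrC.
rewrite !lebesgue_measure_itv/= !lte_fin ltr_pM2r ?invr_gt0//.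
case: ifP => _; last by rewrite mule0.
by rewrite -!EFinD -EFinM; congr EFin; field; lra.
Qed.

(** Lebesgue measure is [k] times its image under multiplication by [k], a map that preserves the
    half-line. Both Laplace transforms below rest on this substitution. *)
Lemma ge0_integral_scale (R : realType) (k : R) (f : R -> \bar R) :
  0 < k -> measurable_fun `](0 : R), +oo[ f ->
  (forall x : R, 0 < x -> (0 <= f x)%E) ->
  (\int[lebesgue_measure]_(x in `]0%R, +oo[) f x =
   \int[lebesgue_measure]_(x in `]0%R, +oo[) (k%:E * f (k * x)%R))%E.
Proof.
move=> k0 mf f0.
pose phi : measurableTypeR R -> measurableTypeR R := fun x => k * x.
have mphi : measurable_fun setT phi by exact: measurable_funM.
pose kn : {nonneg R} := NngNum (ltW k0).
pose m := mscale kn (pushforward (@lebesgue_measure R) phi).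
have phiE : phi @^-1` `]0, +oo[ = `]0, +oo[%classic.
  by apply/seteqP; split => x/=; rewrite !in_itv/= !andbT /phi pmulr_rgt0.
rewrite (@eq_measure_integral _ _ _ _ (m mphi))//; last first.
  by move=> A mA _; exact: lebesgue_measure_scale.
rewrite ge0_integral_mscale//=; last first.
  by move=> x; rewrite in_itv/= andbT; exact: f0.
rewrite ge0_integral_pushforward//=; last first.
  by move=> x; rewrite inE/= in_itv/= andbT; exact: f0.
rewrite phiE -ge0_integralZl//; last 2 first.
- by move=> x /=; rewrite in_itv/= andbT => x0; rewrite f0// mulr_gt0.
- by rewrite lee_fin ltW.
apply: (@measurable_comp _ _ _ _ _ _ `](0 : R), +oo[%classic f _ phi) => //.
  by move=> _ [x /= + <-]; rewrite !in_itv/= !andbT; exact: mulr_gt0.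
exact: measurable_funS mphi.
Qed.

(** * Euler's integral: convergence, positivity and measurability *)

Lemma continuous_powRl (R : realType) (p x : R) : 0 < x ->
  {for x, continuous (fun s : R => s `^ p)}.
Proof.
move=> x0; apply: differentiable_continuous; apply/derivable1_diffP.
by apply: derivable_powR; rewrite in_itv/= x0.
Qed.

(** After taking logarithms this is [ln u <= u] at [u = s / (2 * p)]. The rate 1/2 leaves a decaying
    exponential once multiplied by [exp (- s)]. *)
Lemma powR_le_expR (R : realType) (p s : R) : 0 < p -> 0 < s ->
  s `^ p <= (2 * p) `^ p * expR (s / 2).
Proof.
move=> p0 s0; have p20 : 0 < 2 * p by rewrite mulr_gt0.
rewrite /powR !gt_eqF// -expRD ler_expR.
have -> : s = (2 * p) * (s / (2 * p)) by field; lra.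
rewrite lnM ?posrE ?divr_gt0// mulrDr lerD2l.
have -> : 2 * p * (s / (2 * p)) / 2 = p * (s / (2 * p)) by field; lra.
by rewrite ler_pM2l// ltW// ln_sublinear// divr_gt0.
Qed.

(** The integrand has antiderivative [s^p], so its integral over [[1 / (n + 2), 1]] is at most 1;
    these intervals exhaust []0, 1]] and monotone convergence applies. *)
Lemma integral_powR_le1 (R : realType) (p : R) : 0 < p ->
  (\int[lebesgue_measure]_(s in `]0%R, 1%R]) (p * s `^ (p - 1))%:E <= 1)%E.
Proof.
(* The offset 2 keeps the left endpoint strictly below 1 for every [n], as the fundamental theorem
   of calculus requires. *)
move=> p0; pose F n : set (measurableTypeR R) := `[n.+2%:R^-1, 1]%classic.
have Fgt0 n x : F n x -> 0 < x.
  by rewrite /F/= in_itv/= => /andP[+ _]; apply: lt_le_trans; rewrite invr_gt0.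
have -> : `]0%R, 1%R]%classic = \bigcup_n F n.
  apply/seteqP; split=> [x|x [n _ Fx]] /=.
    rewrite in_itv/= => /andP[x0 x1].
    exists (Num.bound x^-1) => //; rewrite /F/= in_itv/= x1 andbT.
    rewrite invf_ple ?posrE// ltW//.
    have := archi_boundP (ltW (_ : 0 < x^-1)); rewrite invr_gt0 => /(_ x0) h.
    by rewrite (lt_le_trans h)// ler_nat ltnW.
  by rewrite in_itv/= (Fgt0 n)//=; move: Fx; rewrite /F/= in_itv/= => /andP[].
have cvgF : (\int[lebesgue_measure]_(s in F n) (p * s `^ (p - 1))%:E)%E
    @[n --> \oo] -->
    (\int[lebesgue_measure]_(s in \bigcup_n F n) (p * s `^ (p - 1))%:E)%E.
  apply: ge0_nondecreasing_set_cvg_integral.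
  - move=> m n mn; rewrite subsetEset => x; rewrite /F/= !in_itv/= => /andP[+ ->].
    by rewrite andbT; apply: le_trans; rewrite lef_pV2 ?posrE// ler_nat.
  - by move=> n; exact: measurable_itv.
  - move=> n; apply/measurable_EFinP; apply: measurable_funM => //.
    exact: (measurable_funTS (measurable_powR _)).
  - by move=> n x Fx; rewrite lee_fin mulr_ge0 ?powR_ge0// ltW.
rewrite -(cvg_lim _ cvgF)//; apply: lime_le.
  by apply/cvg_ex; eexists; exact: cvgF.
apply: nearW => n.
rewrite (@continuous_FTC2 _ _ (fun s => s `^ p))//.
- by rewrite powR1 -EFinB lee_fin lerBlDr lerDl powR_ge0.
- by rewrite invf_lt1// ltr1n.
- apply: continuous_in_subspaceT => x /set_mem/Fgt0 x0.
  by apply: cvgM; [exact: cvg_cst|exact: continuous_powRl].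
- split.
  + move=> x; rewrite in_itv/= => /andP[x0 _]; apply: derivable_powR.
    by rewrite in_itv/= andbT (lt_trans _ x0)// invr_gt0.
  + by apply: cvg_at_right_filter; apply: continuous_powRl; rewrite invr_gt0.
  + by apply: cvg_at_left_filter; exact: continuous_powRl.
- move=> x; rewrite in_itv/= => /andP[x0 _]; rewrite powR_derive1//.
  by rewrite in_itv/= andbT (lt_trans _ x0)// invr_gt0.
Qed.

Lemma measurable_Gamma_integrand (R : realType) (z : R) :
  measurable_fun [set: R] (fun s : R => s `^ (z - 1) * expR (- s)).
Proof.
apply: measurable_funM; first exact: measurable_powR.
exact: measurableT_comp.
Qed.

(** The integrand is dominated by [s^(z - 1)] on []0, 1]] and by a multiple of the exponential
    density of rate 1/2 on []1, +oo[]. *)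
Lemma integrable_Gamma (R : realType) (z : R) : 0 < z ->
  (@lebesgue_measure R).-integrable `]0, +oo[
    (fun s => (s `^ (z - 1) * expR (- s))%:E).
Proof.
move=> z0; pose f s : R := s `^ (z - 1) * expR (- s).
have mf (D : set R) : measurable_fun D (EFin \o f).
  by apply/measurable_EFinP/measurable_funTS; exact: measurable_Gamma_integrand.
have f0 s : 0 <= f s by rewrite mulr_ge0 ?powR_ge0 ?expR_ge0.
have mp : measurable_fun [set: R] (fun s => (z * s `^ (z - 1))%:E).
  by apply/measurable_EFinP; apply: measurable_funM => //; exact: measurable_powR.
have i1 : (@lebesgue_measure R).-integrable `]0, 1] (EFin \o f).
  apply: (@le_integrable _ (measurableTypeR R) R lebesgue_measure _ _ _
      (fun s => (z^-1)%:E * (z * s `^ (z - 1))%:E)%E) => //.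
  - exact: mf.
  - move=> s; rewrite /= in_itv/= => /andP[s0 s1].
    rewrite lee_fin !ger0_norm//; last first.
      by rewrite mulr_ge0 ?invr_ge0 ?mulr_ge0 ?powR_ge0// ltW.
    rewrite mulrA mulVf ?gt_eqF// mul1r /f ler_piMr ?powR_ge0//.
    by rewrite -expR0 ler_expR oppr_le0 ltW.
  - apply: integrableZl => //; apply/integrableP; split.
    exact: measurable_funTS.
  under eq_integral => s _.
    rewrite gee0_abs ?lee_fin; last by rewrite mulr_ge0 ?powR_ge0// ltW.
    over.
  by rewrite (le_lt_trans (integral_powR_le1 _ _ _))// ltry.
have i2 : (@lebesgue_measure R).-integrable `]1, +oo[ (EFin \o f).
  (* The first factor comes from [powR_le_expR] at [p = z]; the factor 2 cancels the normalization
     1/2 of the exponential density. *)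
  pose C : R := (2 * z) `^ z * 2.
  apply: (@le_integrable _ (measurableTypeR R) R lebesgue_measure _ _ _
      (fun s => C%:E * (EFin \o exponential_pdf 2^-1) s)%E) => //;
    [exact: mf| |]; last first.
    apply: integrableZl => //; apply: (@integrableS _ _ _ _ setT) => //.
    by apply: integrable_exponential_pdf; rewrite invr_gt0.
  move=> s; rewrite /= in_itv/= andbT => s1; have s0 := lt_trans ltr01 s1.
  rewrite lee_fin exponential_pdfE ?(ltW s0)// !ger0_norm//; last first.
    by rewrite /C !mulr_ge0 ?powR_ge0 ?expR_ge0.
  have -> : C * (2^-1 * expR (- 2^-1 * s)) =
      (2 * z) `^ z * expR (s / 2) * expR (- s).
    by rewrite /C -!mulrA mulVKf// -expRD; congr (_ * expR _); lra.
  rewrite /f ler_pM2r ?expR_gt0//.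
  apply: le_trans (powR_le_expR _ _ _ z0 s0).
  by apply: ler_powR; [exact: ltW|lra].
rewrite (@itv_bndbnd_setU _ _ _ (BRight 1))//.
apply/integrableP; split; first exact: mf.
rewrite ge0_integral_setU//=.
- by apply: lte_add_pinfty; [case/integrableP: i1|case/integrableP: i2].
- by apply: (measurableT_comp (f := abse)) (mf _).
- apply/disj_setPS => s [] /=; rewrite !in_itv/= andbT => /andP[_ s1].
  by rewrite ltNge s1.
- by rewrite bnd_simp.
Qed.

Lemma GammaE (R : realType) (z : R) : 0 < z ->
  (Gamma z)%:E =
  (\int[lebesgue_measure]_(s in `]0%R, +oo[) (s `^ (z - 1) * expR (- s))%:E)%E.
Proof.
move=> z0; rewrite /Gamma /Rintegral fineK//; apply: integrable_fin_num => //.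
exact: integrable_Gamma.
Qed.

Lemma Gamma_ge0 (R : realType) (z : R) : 0 <= Gamma z.
Proof. by apply: Rintegral_ge0 => s _; rewrite mulr_ge0 ?powR_ge0 ?expR_ge0. Qed.

(* Only the part of Euler's integral over [M, M + 1] is kept. *)
Lemma Gamma_ge (R : realType) (M z : R) : 0 < M -> 0 < z ->
  M `^ z / (M + 1) * expR (- (M + 1)) <= Gamma z.
Proof.
move=> M0 z0; rewrite -lee_fin GammaE//.
have -> : (M `^ z / (M + 1) * expR (- (M + 1)))%:E =
    (\int[lebesgue_measure]_(s in `[M, (M + 1)%R])
       cst (M `^ z / (M + 1) * expR (- (M + 1)))%:E s)%E.
  rewrite integral_cst//= lebesgue_measure_itv/= lte_fin ltrDl ltr01.
  by rewrite -EFinD addrAC subrr add0r mule1.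
have mf (D : set R) : measurable_fun D
    (fun s : R => (s `^ (z - 1) * expR (- s))%:E).
  by apply/measurable_EFinP/measurable_funTS; exact: measurable_Gamma_integrand.
have f0 (s : R) : (0 <= (s `^ (z - 1) * expR (- s))%:E)%E.
  by rewrite lee_fin mulr_ge0 ?powR_ge0 ?expR_ge0.
apply: (@le_trans _ _ (\int[lebesgue_measure]_(s in `[M, (M + 1)%R])
    (s `^ (z - 1) * expR (- s))%:E)%E); last first.
  apply: ge0_subset_integral => //; first exact: mf.
  move=> s /=; rewrite !in_itv/= andbT => /andP[Ms _].
  exact: lt_le_trans Ms.
apply: ge0_le_integral => //; [|exact: mf|].
  by move=> s _; rewrite lee_fin mulr_ge0 ?expR_ge0// divr_ge0 ?powR_ge0//; lra.
move=> s /=; rewrite in_itv/= => /andP[Ms sM]; rewrite lee_fin.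
have s0 : 0 < s by exact: lt_le_trans Ms.
rewrite ler_pM ?expR_ge0//.
- by rewrite divr_ge0 ?powR_ge0//; lra.
(* Writing [s^(z - 1)] as [s^z / s] avoids a case split on the sign of [z - 1]: [s^z >= M^z] and
   [s <= M + 1]. *)
- rewrite powRB; last by rewrite (gt_eqF s0) implybT.
  rewrite powRr1 ?(ltW s0)// ler_pM ?powR_ge0//.
  + by rewrite invr_ge0; lra.
  + by apply: ge0_ler_powR; rewrite ?nnegrE// ?ltW.
  + by rewrite lef_pV2 ?posrE//; lra.
- by rewrite ler_expR lerN2.
Qed.

Lemma Gamma_gt0 (R : realType) (z : R) : 0 < z -> 0 < Gamma z.
Proof.
move=> z0; apply: lt_le_trans (Gamma_ge _ 1 _ ltr01 z0).
by rewrite mulr_gt0 ?expR_gt0// divr_gt0 ?powR_gt0.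
Qed.

(** By Tonelli, integrating out one variable of a nonnegative jointly measurable function leaves a
    measurable function; [fine] turns its infinite values into 0. *)
Lemma measurable_Gamma (R : realType) : measurable_fun [set: R] (@Gamma R).
Proof.
(* The power is spelled out as an exponential of a logarithm, which makes joint measurability
   visible; the indicator encodes the domain of integration. *)
pose f (p : R * R) : \bar R :=
  (expR ((p.1 - 1) * ln p.2) * expR (- p.2) * \1_(`]0, +oo[%classic : set R) p.2)%:E.
have mf : measurable_fun setT f.
  apply/measurable_EFinP; apply: measurable_funM.
    apply: measurable_funM; apply: measurableT_comp => //.
      apply: measurable_funM; first exact: measurable_funB.
      by apply: measurableT_comp => //; exact: measurable_ln.
    by apply: measurableT_comp.
  by apply: measurableT_comp => //; exact: measurable_indic.
have f0 p : (0 <= f p)%E.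
  by rewrite lee_fin !mulr_ge0 ?expR_ge0.
have mF := measurable_fun_fubini_tonelli_F (m2 := @lebesgue_measure R) f mf f0.
have -> : @Gamma R = fine \o fubini_F (@lebesgue_measure R) f.
  apply/funext => z; rewrite /Gamma /Rintegral /fubini_F/= integral_mkcond.
  congr fine; apply: eq_integral => s _; rewrite patchE /f/= indicE.
  case: ifPn => [/set_mem/=|_]; last by rewrite mulr0.
  by rewrite in_itv/= andbT => s0; rewrite mulr1 /powR gt_eqF.
exact: measurableT_comp.
Qed.

(** On nonnegative reals, zero included, inversion is the power [-1], and powers are measurable. *)
Lemma measurable_GammaV (R : realType) :
  measurable_fun [set: R] (fun z : R => (Gamma z)^-1).
Proof.
rewrite (_ : (fun z => _) = (@powR R ^~ (-1)) \o @Gamma R).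
  by apply: measurableT_comp; [exact: measurable_powR|exact: measurable_Gamma].
by apply/funext => z /=; rewrite powR_inv1// Gamma_ge0.
Qed.

(** * The integral [nu] at [-1] and the Laplace transform in time *)

Lemma powR_exp (R : realType) (x y s : R) : 0 < x ->
  (x * expR y) `^ s = x `^ s * expR (s * y).
Proof.
by move=> x0; rewrite powRM ?expR_ge0 ?(ltW x0)// -expRM [y * s]mulrC.
Qed.

Lemma rgammaE (R : realType) (z : R) : 0 < z -> rgamma z = (Gamma z)^-1.
Proof.
move=> z0; rewrite /rgamma (_ : Num.truncn (1 - z) = 0%N).
  by rewrite big_ord0 mul1r addr0.
by apply/truncn0Pn; rewrite -ltNge; lra.
Qed.

Lemma measurable_nu_integrand (R : realType) (z : R) :
  measurable_fun [set: R] (fun y : R => z `^ (y - 1) / Gamma y).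
Proof.
apply: measurable_funM; last exact: measurable_GammaV.
apply: (measurableT_comp (f := powR z)); first exact: measurable_powRr.
exact: measurable_funB.
Qed.

Lemma nu_integrand_ge0 (R : realType) (z y : R) :
  0 <= z `^ (y - 1) / Gamma y.
Proof. by rewrite divr_ge0 ?powR_ge0 ?Gamma_ge0. Qed.

(* With M = z * e, the lower bound Gamma y >= c * M ^ y makes the integrand
   O(exp (- y)). *)
Lemma integrable_nu (R : realType) (z : R) : 0 < z ->
  (@lebesgue_measure R).-integrable `]0, +oo[
    (fun y => (z `^ (y - 1) / Gamma y)%:E).
Proof.
move=> z0; pose M : R := z * expR 1.
have M0 : 0 < M by rewrite mulr_gt0 ?expR_gt0.
(* [C] is chosen so that replacing [Gamma y] by its lower bound gives an equality:
   [M^y = z^y * exp y] absorbs [exp (- y)]. *)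
pose C : R := z^-1 * (M + 1) * expR (M + 1).
have C0 : 0 <= C by rewrite !mulr_ge0 ?invr_ge0 ?expR_ge0//; lra.
apply: (@le_integrable _ (measurableTypeR R) R lebesgue_measure _ _ _
  (fun y => C%:E * (EFin \o exponential_pdf 1) y)%E) => //; last first.
- apply: integrableZl => //; apply: (@integrableS _ _ _ _ setT) => //.
  by apply: integrable_exponential_pdf; rewrite ltr01.
- move=> y; rewrite /= in_itv/= andbT => y0; rewrite lee_fin.
  rewrite exponential_pdfE ?(ltW y0)// mul1r mulN1r !ger0_norm; last 2 first.
    by rewrite mulr_ge0 ?expR_ge0.
    exact: nu_integrand_ge0.
  rewrite ler_pdivrMr ?Gamma_gt0//.
  apply: le_trans (ler_wpM2l _ (Gamma_ge _ M _ M0 y0)); last first.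
    by rewrite mulr_ge0 ?expR_ge0.
  rewrite /M powR_exp// mulr1 -/M powRB; last by rewrite (gt_eqF z0) implybT.
  rewrite powRr1 ?(ltW z0)// le_eqVlt; apply/orP; left; apply/eqP.
  rewrite /C !expRN; field.
  by rewrite !gt_eqF ?expR_gt0//; lra.
- by apply/measurable_EFinP/measurable_funTS; exact: measurable_nu_integrand.
Qed.

Lemma nu_N1E (R : realType) (z : R) : 0 < z ->
  (nu z (-1))%:E =
  (\int[lebesgue_measure]_(y in `]0%R, +oo[) (z `^ (y - 1) / Gamma y)%:E)%E.
Proof.
move=> z0; pose f (y : R) := z `^ (-1 + y) * rgamma (-1 + y + 1).
have fE (y : R) : y \in (`]0, +oo[%classic : set R) ->
    z `^ (y - 1) / Gamma y = f y.
  rewrite inE/= in_itv/= andbT => y0.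
  by rewrite /f [-1 + y]addrC subrK rgammaE.
have intE : (\int[lebesgue_measure]_(y in `[0%R, +oo[) (f y)%:E =
    \int[lebesgue_measure]_(y in `]0%R, +oo[) (z `^ (y - 1) / Gamma y)%:E)%E.
  (* The endpoint 0 is a null set; for [y > 0] the reciprocal gamma function is the inverse of
     Euler's integral. *)
  rewrite -integral_itv_obnd_cbnd.
    by apply: eq_integral => y /fE ->.
  apply/measurable_EFinP; apply: eq_measurable_fun fE _.
  by apply: measurable_funTS; exact: measurable_nu_integrand.
rewrite /nu /Rintegral intE fineK//; apply: integrable_fin_num => //.
exact: integrable_nu.
Qed.

(** The integrand equals [a * K * z^(a t - 1) / Gamma (a t)], and the substitution [y = a t]
    consumes the factor [a]. *)
Lemma laplace_time_gamma_density (R : realType) (a b x lam : R) :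
  0 < a -> 0 < b -> 0 < x ->
  (\int[lebesgue_measure]_(t in `]0%R, +oo[)
     (expR (- (lam * t)) * gamma_density a b t x)%:E)%E =
  (expR (- (b * x)) * (b / a) * expR (- (lam / a))
     * nu (b * x * expR (- (lam / a))) (-1))%:E.
Proof.
move=> a0 b0 x0; set K := _ * (b / a) * _; set z := b * x * _.
have K0 : 0 <= K by rewrite !mulr_ge0 ?expR_ge0 ?invr_ge0 ?(ltW a0) ?(ltW b0).
have z0 : 0 < z by rewrite !mulr_gt0 ?expR_gt0.
have mf (D : set R) : measurable_fun D (fun y : R => (z `^ (y - 1) / Gamma y)%:E).
  by apply/measurable_EFinP/measurable_funTS; exact: measurable_nu_integrand.
rewrite EFinM nu_N1E// -ge0_integralZl//; last 2 first.
- exact: mf.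
- by move=> y _; rewrite lee_fin nu_integrand_ge0.
rewrite [RHS](ge0_integral_scale _ _ _ a0); last 2 first.
- by apply: measurable_funeM; exact: mf.
- by move=> y _; rewrite mule_ge0// lee_fin nu_integrand_ge0.
apply: eq_integral => t; rewrite inE/= in_itv/= andbT => t0.
have at0 : 0 < a * t by exact: mulr_gt0.
rewrite -!EFinM; congr EFin; rewrite /gamma_density /z.
rewrite powR_exp ?mulr_gt0// powRM ?(ltW b0) ?(ltW x0)//.
rewrite (@powRB _ b); last by rewrite (gt_eqF b0) implybT.
rewrite powRr1 ?(ltW b0)//.
(* The exponential part of [z^(a t - 1)] thus yields the Laplace kernel [exp (- lam t)] and a
   constant [exp (lam / a)], which [K] compensates. *)
have -> : (a * t - 1) * - (lam / a) = lam / a - lam * t by field; lra.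
rewrite /K expRD !expRN; field.
by rewrite !gt_eqF ?expR_gt0 ?Gamma_gt0.
Qed.

(** * The gamma density and its Laplace transform in space *)

Lemma measurable_gamma_density (R : realType) (a b t : R) :
  measurable_fun [set: R] (gamma_density a b t).
Proof.
apply: measurable_funM.
  by apply: measurable_funM => //; exact: measurable_powR.
by apply: measurableT_comp => //; exact: measurableT_comp.
Qed.

Lemma gamma_density_ge0 (R : realType) (a b t x : R) :
  0 <= gamma_density a b t x.
Proof. by rewrite !mulr_ge0 ?powR_ge0 ?expR_ge0 ?invr_ge0 ?Gamma_ge0. Qed.

(** The substitution [s = (b + lam) * x] reduces the integral to Euler's, with value
    [(b / (b + lam))^(a t)], which is the exponential on the right. *)
Lemma laplace_gamma_density (R : realType) (a b t lam : R) :
  0 < a -> 0 < b -> 0 < t -> 0 <= lam ->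
  (\int[lebesgue_measure]_(x in `]0%R, +oo[)
     (expR (- (lam * x)) * gamma_density a b t x)%:E)%E =
  (expR (- (t * gamma_exponent a b lam)))%:E.
Proof.
move=> a0 b0 t0 lam0; have c0 : 0 < a * t by exact: mulr_gt0.
rewrite /gamma_density; set c := a * t in c0 *.
have k0 : 0 < b + lam by lra.
pose K := b `^ c / (Gamma c * (b + lam) `^ c).
have K0 : 0 <= K by rewrite divr_ge0 ?powR_ge0// mulr_ge0 ?powR_ge0 ?Gamma_ge0.
have mf (D : set R) : measurable_fun D
    (fun s : R => (s `^ (c - 1) * expR (- s))%:E).
  by apply/measurable_EFinP/measurable_funTS; exact: measurable_Gamma_integrand.
have f0 (s : R) : (0 <= (s `^ (c - 1) * expR (- s))%:E)%E.
  by rewrite lee_fin mulr_ge0 ?powR_ge0 ?expR_ge0.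
transitivity (K%:E * (Gamma c)%:E)%E; last first.
  rewrite -EFinM /gamma_exponent; congr EFin.
  have -> : 1 + lam / b = (b + lam) / b by field; rewrite gt_eqF.
  rewrite ln_div ?posrE// /K /powR !gt_eqF//.
  have -> : - (t * (a * (ln (b + lam) - ln b))) =
      c * ln b + - (c * ln (b + lam)) by rewrite /c; ring.
  rewrite expRD expRN; field.
  by rewrite !gt_eqF ?expR_gt0 ?Gamma_gt0.
rewrite GammaE// -ge0_integralZl//; last exact: mf.
rewrite [RHS](ge0_integral_scale _ _ _ k0); last 2 first.
- by apply: measurable_funeM; exact: mf.
- by move=> s _; rewrite mule_ge0// lee_fin.
apply: eq_integral => x; rewrite inE/= in_itv/= andbT => x0.
rewrite -!EFinM; congr EFin.
rewrite powRM ?(ltW k0) ?(ltW x0)// (@powRB _ (b + lam)); last first.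
  by rewrite (gt_eqF k0) implybT.
have -> : - ((b + lam) * x) = - (lam * x) + - (b * x) by ring.
rewrite (powRr1 (ltW k0)) expRD !expRN /K; field.
by rewrite !gt_eqF ?expR_gt0 ?powR_gt0 ?Gamma_gt0.
Qed.

(** * Recovery of tails from the Laplace transform *)

(** The inductive step discards the nonnegative term [m * v^2]. *)
Lemma bernoulli_onemX (R : realDomainType) (v : R) (m : nat) :
  0 <= v <= 1 -> 1 - m%:R * v <= (1 - v) ^+ m.
Proof.
move=> /andP[v0 v1]; elim: m => [|m IH]; first by rewrite expr0 mul0r subr0.
rewrite exprS; apply: le_trans (ler_wpM2l _ IH); last by rewrite subr_ge0.
have m0 : 0 <= m%:R * v * v by rewrite !mulr_ge0.
by rewrite -natr1; lra.
Qed.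

Lemma cvg_expRNn (R : realType) (k : R) : 0 < k ->
  expR (- (n%:R * k)) @[n --> \oo] --> (0 : R).
Proof.
move=> k0; apply: (@cvg_comp _ _ _ (fun n : nat => n%:R * k)
  (fun x => expR (- x)) _ (pinfty_nbhs R)); last exact: cvgr_expR.
have /cvgryPge idy := @cvgr_idn R.
by apply/cvgryPge => A; apply: filterS (idy (A / k)) => n; rewrite ler_pdivrMr.
Qed.

(* The exponent grows like n * exp (n * c), so that (1 - exp (- n * x)) ^ m is
   close to exp (- n * exp (n * (c - x))). *)
Definition tail_exponent {R : realType} (c : R) (n : nat) : nat :=
  (Num.truncn (n%:R * expR (n%:R * c))).+1.

(** Write [v = exp (- n x)] and let [m] be the exponent. If [x <= c], then [m * v >= n], so
    [(1 - v)^m <= exp (- m v) <= exp (- n)]; the factor [n] in [m] settles the boundary case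
    [x = c]. If [x > c], then [m * v] tends to 0 and Bernoulli's inequality gives the limit 1. *)
Lemma cvg_tail_indicator (R : realType) (c x : R) : 0 <= x -> 0 <= c ->
  (1 - expR (- (n%:R * x))) ^+ tail_exponent c n @[n --> \oo] -->
  ((c < x)%R%:R : R).
Proof.
move=> x0 c0.
have v01 n : 0 <= expR (- (n%:R * x)) <= 1.
  by rewrite expR_ge0/= -expR0 ler_expR oppr_le0 mulr_ge0.
have mge n : n%:R * expR (n%:R * c) <= (tail_exponent c n)%:R.
  by rewrite ltW// truncnS_gt.
have mle n : (tail_exponent c n)%:R <= n%:R * expR (n%:R * c) + 1.
  by rewrite -natr1 lerD2r truncn_le// mulr_ge0 ?expR_ge0.
have [cx|xc] := ltP c x; last first.
  apply: (@squeeze_cvgr _ _ _ _ (cst 0) (fun n : nat => expR (- (n%:R * 1)))).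
  - apply: nearW => n; have /andP[v0 v1] := v01 n.
    rewrite exprn_ge0 ?subr_ge0//= mulr1.
    apply: (@le_trans _ _ (expR (- expR (- (n%:R * x))) ^+ tail_exponent c n)).
      rewrite lerXn2r ?nnegrE ?expR_ge0 ?subr_ge0//.
      by have := expR_ge1Dx (- expR (- (n%:R * x))).
    rewrite -expRM_natl mulrN ler_expR lerN2.
    apply: le_trans (ler_wpM2r v0 (mge n)).
    rewrite -mulrA -expRD ler_peMr// -expR0 ler_expR -mulrN -mulrDr.
    by rewrite mulr_ge0//; lra.
  - exact: cvg_cst.
  - exact: cvg_expRNn.
pose del := x - c; have d0 : 0 < del by rewrite subr_gt0.
apply: (@squeeze_cvgr _ _ _ _
  (fun n : nat => 1 - (2 / del + 1) * expR (- (n%:R * (del / 2)))) (cst 1)).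
- apply: nearW => n; have /andP[v0 v1] := v01 n; apply/andP; split; last first.
    by rewrite exprn_ile1 ?subr_ge0// lerBlDr lerDl.
  apply: le_trans (bernoulli_onemX _ _ _ (v01 n)).
  rewrite lerD2l lerN2; apply: le_trans (ler_wpM2r v0 (mle n)) _.
  rewrite mulrDl mulrDl mul1r; apply: lerD; last first.
    rewrite mul1r ler_expR lerN2 ler_wpM2l// /del; lra.
  (* The decay [exp (- n * del)] is split into two halves: [1 + y <= exp y] at [y = n * del / 2]
     gives [n * w <= 2 / del], and the other [w] remains. *)
  set w := expR (- (n%:R * (del / 2))).
  have -> : n%:R * expR (n%:R * c) * expR (- (n%:R * x)) = (n%:R * w) * w.
    by rewrite -!mulrA -!expRD; congr (_ * expR _); rewrite /del; lra.
  rewrite ler_pM2r ?expR_gt0// /w expRN ler_pdivrMr ?expR_gt0//.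
  rewrite -(@ler_pM2l _ (del / 2)) ?divr_gt0// [X in _ <= X]mulrA.
  have -> : del / 2 * (2 / del) = 1 by field; rewrite gt_eqF.
  rewrite mul1r mulrC; apply: le_trans (expR_ge1Dx _); lra.
- rewrite -[X in _ --> X]subr0 -[X in _ - X](mulr0 (2 / del + 1)).
  apply: cvgB; first exact: cvg_cst.
  by apply: cvgMr; apply: cvg_expRNn; rewrite divr_gt0.
- exact: cvg_cst.
Qed.

Section laplace_tail.
Context {R : realType} {d : measure_display} {T : measurableType d}.
Variables (mu : {measure set T -> \bar R}) (D : set T) (X g : T -> R).

(** The weight [g] lets one argument serve both a probability, with [g = 1], and a density against
    Lebesgue measure. The parameter [lam] makes the recursion in [m] close up. *)
Definition weighted_laplace (lam : R) (n m : nat) : \bar R :=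
  (\int[mu]_(w in D)
    (expR (- (lam * X w)) * (1 - expR (- (n%:R * X w))) ^+ m * g w)%:E)%E.

Hypotheses (mD : measurable D) (mX : measurable_fun D X).
Hypotheses (X_ge0 : forall w, D w -> 0 <= X w) (g_ge0 : forall w, D w -> 0 <= g w).
Hypothesis ig : mu.-integrable D (EFin \o g).

Let mg : measurable_fun D g.
Proof. exact/measurable_EFinP/(measurable_int mu ig). Qed.

Let mexp (lam : R) : measurable_fun D (fun w => expR (- (lam * X w))).
Proof. by do 2 apply: measurableT_comp => //; exact: measurable_funM. Qed.

Let mweight (lam : R) (n m : nat) : measurable_fun D
  (fun w => expR (- (lam * X w)) * (1 - expR (- (n%:R * X w))) ^+ m * g w).
Proof.
apply: measurable_funM => //; apply: measurable_funM => //.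
by apply: measurable_funX; apply: measurable_funB.
Qed.

Let expR01 (lam : R) (w : T) : 0 <= lam -> D w ->
  0 <= expR (- (lam * X w)) <= 1.
Proof.
move=> lam0 Dw; rewrite expR_ge0/= -expR0 ler_expR oppr_le0.
by rewrite mulr_ge0 ?X_ge0.
Qed.

Let weight_bound (lam : R) (n m : nat) (w : T) : 0 <= lam -> D w ->
  `|expR (- (lam * X w)) * (1 - expR (- (n%:R * X w))) ^+ m * g w| <= g w.
Proof.
move=> lam0 Dw; have /andP[u0 u1] := expR01 _ _ lam0 Dw.
have /andP[v0 v1] := expR01 n%:R _ (ler0n _ _) Dw.
have p0 : 0 <= (1 - expR (- (n%:R * X w))) ^+ m by rewrite exprn_ge0// subr_ge0.
rewrite ger0_norm; last by rewrite !mulr_ge0// g_ge0.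
rewrite ler_piMl ?g_ge0// mulr_ile1// exprn_ile1 ?subr_ge0//.
Qed.

Lemma integrable_weighted_laplace (lam : R) (n m : nat) : 0 <= lam ->
  mu.-integrable D (fun w =>
    (expR (- (lam * X w)) * (1 - expR (- (n%:R * X w))) ^+ m * g w)%:E).
Proof.
move=> lam0; apply: le_integrable ig => //; first exact/measurable_EFinP.
by move=> w Dw; rewrite lee_fin (le_trans (weight_bound _ _ _ _ lam0 Dw)) ?ler_norm.
Qed.

(** One factor [1 - exp (- n X)] is expanded and its exponential is merged with [exp (- lam X)].
    Iteration brings everything down to [m = 0], the plain Laplace transform. *)
Lemma weighted_laplaceS (lam : R) (n m : nat) : 0 <= lam ->
  weighted_laplace lam n m.+1 =
  (weighted_laplace lam n m - weighted_laplace (lam + n%:R) n m)%E.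
Proof.
move=> lam0; rewrite /weighted_laplace -integralB_EFin//; last 2 first.
- exact: integrable_weighted_laplace.
- by apply: integrable_weighted_laplace; rewrite addr_ge0.
apply: eq_integral => w _; rewrite -EFinB; congr EFin.
by rewrite mulrDl opprD expRD exprS; ring.
Qed.

(** Dominated convergence with majorant [g]: at [lam = 0] the remaining weight tends to the
    indicator of [X > c]. *)
Lemma cvg_weighted_laplace (c : R) : 0 <= c ->
  weighted_laplace 0 n (tail_exponent c n) @[n --> \oo] -->
  (\int[mu]_(w in D `&` X @^-1` `]c, +oo[) (g w)%:E)%E.
Proof.
move=> c0; pose f w : \bar R := ((c < X w)%R%:R * g w)%:E.
pose f_ n w : \bar R := (expR (- (0 * X w)) *
  (1 - expR (- (n%:R * X w))) ^+ tail_exponent c n * g w)%:E.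
have f_f w : D w -> f_ n w @[n --> \oo] --> f w.
  move=> Dw; apply: cvg_EFin; first exact: nearW.
  under eq_fun do rewrite /f_/= mul0r oppr0 expR0 mul1r.
  by apply: cvgMl; apply: cvg_tail_indicator => //; exact: X_ge0.
have mf_ n : measurable_fun D (f_ n) by exact/measurable_EFinP.
have mf : measurable_fun D f by exact: emeasurable_fun_cvg f_f.
have [|||||_ _] := @dominated_convergence _ T R mu D mD f_ f (EFin \o g) => //.
- exact: aeW.
- by apply: aeW => w n Dw; rewrite lee_fin; exact: weight_bound.
suff -> : (\int[mu]_(w in D `&` X @^-1` `]c, +oo[) (g w)%:E)%E =
  (\int[mu]_(w in D) f w)%E by [].
rewrite integral_mkcondr; apply: eq_integral => w _.
rewrite patchE /f; case: ifPn => [/set_mem/=|/negP].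
  by rewrite in_itv/= andbT => ->; rewrite mul1r.
rewrite inE/= in_itv/= andbT => /negP/negbTE ->.
by rewrite mul0r.
Qed.

End laplace_tail.

(** The two sides live on different spaces, so that a random variable can be compared with the
    identity on the half-line carrying a density. *)
Lemma laplace_tail_unique (R : realType) (d1 d2 : measure_display)
    (T1 : measurableType d1) (T2 : measurableType d2)
    (mu1 : {measure set T1 -> \bar R}) (mu2 : {measure set T2 -> \bar R})
    (D1 : set T1) (D2 : set T2) (X1 g1 : T1 -> R) (X2 g2 : T2 -> R) :
  measurable D1 -> measurable D2 ->
  measurable_fun D1 X1 -> measurable_fun D2 X2 ->
  (forall w, D1 w -> 0 <= X1 w) -> (forall w, D2 w -> 0 <= X2 w) ->
  (forall w, D1 w -> 0 <= g1 w) -> (forall w, D2 w -> 0 <= g2 w) ->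
  mu1.-integrable D1 (EFin \o g1) -> mu2.-integrable D2 (EFin \o g2) ->
  (forall lam, 0 <= lam ->
    (\int[mu1]_(w in D1) (expR (- (lam * X1 w)) * g1 w)%:E =
     \int[mu2]_(w in D2) (expR (- (lam * X2 w)) * g2 w)%:E)%E) ->
  forall c,
    (\int[mu1]_(w in D1 `&` X1 @^-1` `]c, +oo[) (g1 w)%:E =
     \int[mu2]_(w in D2 `&` X2 @^-1` `]c, +oo[) (g2 w)%:E)%E.
Proof.
move=> mD1 mD2 mX1 mX2 X10 X20 g10 g20 i1 i2 laplaceE c.
(* For [c < 0] the tail is the whole domain, and the claim is the hypothesis at [lam = 0]. *)
have [c0|c0] := leP 0 c; last first.
  have DE (T : Type) (D : set T) (X : T -> R) : (forall w, D w -> 0 <= X w) ->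
      D `&` X @^-1` `]c, +oo[ = D.
    move=> X0; apply/seteqP; split => [w []//|w Dw]; split => //=.
    by rewrite in_itv/= andbT (lt_le_trans c0)// X0.
  rewrite !DE//; have laplace0 := laplaceE 0 (lexx 0).
  by etransitivity; last (etransitivity; first exact: laplace0);
    apply: eq_integral => w _; rewrite mul0r oppr0 expR0 mul1r.
(* The induction on [m] must keep [lam] general, since the recursion shifts it by [n]. *)
have wE n m lam : 0 <= lam ->
    weighted_laplace mu1 D1 X1 g1 lam n m = weighted_laplace mu2 D2 X2 g2 lam n m.
  elim: m lam => [|m IH] lam lam0; last first.
    by rewrite !weighted_laplaceS// !IH// addr_ge0.
  rewrite /weighted_laplace; under eq_integral do rewrite expr0 mulr1.
  by rewrite laplaceE//; apply: eq_integral => w _; rewrite expr0 mulr1.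
have cvg1 := cvg_weighted_laplace _ _ _ _ mD1 mX1 X10 g10 i1 _ c0.
have cvg2 := cvg_weighted_laplace _ _ _ _ mD2 mX2 X20 g20 i2 _ c0.
rewrite -(cvg_lim _ cvg1)// -(cvg_lim _ cvg2)//.
by congr (limn _); apply/funext => n; rewrite wE.
Qed.

(** * The gamma law as a measure and the law of [H t] *)

(** Bundled below as a measure, so that uniqueness of measures on a generating family applies to
    it. *)
Definition gamma_law {R : realType} (a b t : R) (A : set R) : \bar R :=
  (\int[lebesgue_measure]_(x in A `&` `]0%R, +oo[) (gamma_density a b t x)%:E)%E.

Section gamma_law_measure.
Context {R : realType} (a b t : R).

Let gamma_law0 : gamma_law a b t set0 = 0%E.
Proof. by rewrite /gamma_law set0I integral_set0. Qed.

Let gamma_law_ge0 A : (0 <= gamma_law a b t A)%E.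
Proof. by apply: integral_ge0 => x _; rewrite lee_fin gamma_density_ge0. Qed.

Let gamma_law_sigma_additive : semi_sigma_additive (gamma_law a b t).
Proof.
move=> /= F mF tF mUF; rewrite /gamma_law setI_bigcupl.
have mFI n : measurable (F n `&` `]0, +oo[) by exact: measurableI.
apply: cvg_toP.
  apply: ereal_nondecreasing_is_cvgn => m n mn.
  apply: lee_sum_nneg_natr => // k _ _; apply: integral_ge0 => x _.
  by rewrite lee_fin gamma_density_ge0.
rewrite ge0_integral_bigcup//=.
- apply/measurable_EFinP; apply: measurable_funTS.
  exact: measurable_gamma_density.
- by move=> x _; rewrite lee_fin gamma_density_ge0.
- exact: trivIset_setIr.
Qed.

HB.instance Definition _ := isMeasure.Build _ _ _
  (gamma_law a b t) gamma_law0 gamma_law_ge0 gamma_law_sigma_additive.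

End gamma_law_measure.

Lemma gamma_subordinator_density (R : realType) (a b : R)
    (d : measure_display) (T : measurableType d) (P : probability T R)
    (H : R -> {RV P >-> R}) :
  0 < a -> 0 < b -> subordinator H ->
  laplace_exponent H (gamma_exponent a b) ->
  forall t : R, 0 < t -> has_density (H t) (gamma_density a b t).
Proof.
move=> a0 b0 [H_ae _ _] HPhi t t0.
(* Almost every path starts at 0 and is nondecreasing, so [D] has full probability; restricting to
   [D] makes [X] nonnegative everywhere. *)
pose X : T -> R := H t; pose D := X @^-1` `[0, +oo[.
have mX : measurable_fun setT X by exact: measurable_funP.
have mD : measurable D by rewrite -[D]setTI; exact: mX.
have negD : P.-negligible (~` D).
  case: H_ae => N [mN N0 subN]; exists N; split => // w nDw.
  apply: subN => -[H0w Hmono _]; apply: nDw.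
  by rewrite /D/= in_itv/= andbT -H0w; apply: Hmono => //; exact: ltW.
have PD0 : P (~` D) = 0%E by apply/negligibleP => //; exact: measurableC.
have laplaceX lam : 0 <= lam ->
    (\int[P]_(w in D) (expR (- (lam * X w)) * 1)%:E =
     (expR (- (t * gamma_exponent a b lam)))%:E)%E.
  move=> lam0; rewrite -(HPhi t lam (ltW t0) lam0) unlock.
  rewrite (@ge0_negligible_integral _ _ _ _ setT (~` D))//=; last 2 first.
  - exact: measurableC.
  - apply/measurable_EFinP; do 2 apply: measurableT_comp => //.
    exact: measurable_funM.
  by rewrite setTD setCK; apply: eq_integral => w _; rewrite mulr1.
have tailE c : distribution P (H t) `]c, +oo[ = gamma_law a b t `]c, +oo[.
  have mB : measurable (X @^-1` `]c, +oo[).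
    by rewrite -[X in measurable X]setTI; exact: mX.
  have PBE : P (X @^-1` `]c, +oo[) =
      (\int[P]_(w in D `&` X @^-1` `]c, +oo[) 1%:E)%E.
    rewrite -[LHS]mul1e -(integral_cst P mB).
    rewrite (@ge0_negligible_integral _ _ _ _ _ (~` D))//.
      by rewrite setDE setCK setIC.
    exact: measurableC.
  rewrite /distribution/pushforward PBE /gamma_law [in RHS]setIC.
  (* The comparison is between [X] under [P] with weight 1 and the identity under Lebesgue measure
     with the gamma density as weight. *)
  apply: (laplace_tail_unique R _ _ T (measurableTypeR R)
    P lebesgue_measure D `]0, +oo[%classic X
    (fun=> 1) idfun (gamma_density a b t)) => //.
  - exact: measurable_funTS.
  - by apply: measurable_funTS; exact: measurable_id.
  - by move=> w; rewrite /D/= in_itv/= andbT.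
  - by move=> x; rewrite /= in_itv/= andbT => /ltW.
  - by move=> x _; exact: gamma_density_ge0.
  - exact: finite_measure_integrable_cst.
  - have mg : measurable_fun `](0 : R), +oo[ (EFin \o gamma_density a b t).
      apply/measurable_EFinP; apply: measurable_funTS.
      exact: measurable_gamma_density.
    apply/integrableP; split => //.
    (* Finiteness of the total mass is the Laplace formula at [lam = 0]. *)
    have laplace0 := laplace_gamma_density _ _ _ _ _ a0 b0 t0 (lexx 0).
    rewrite [X in (X < _)%E](_ : _ = (expR (- (t * gamma_exponent a b 0)))%:E).
      by rewrite ltry.
    rewrite -laplace0; apply: eq_integral => x _.
    rewrite /= ger0_norm ?gamma_density_ge0//.
    by rewrite mul0r oppr0 expR0 mul1r.
  - by move=> lam lam0; rewrite laplaceX// laplace_gamma_density.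
move=> A mA; change (distribution P (H t) A = gamma_law a b t A).
pose m1 : {measure set R -> \bar R} := distribution P (H t).
pose m2 : {measure set R -> \bar R} := gamma_law a b t.
(* The open right rays generate the Borel sets and are stable under intersection; those starting at
   [- n] cover the line and have finite mass. *)
pose G : set (set R) := [set B | exists x, B = `]x, +oo[%classic].
apply: (@measure_unique _ R R G
  (fun n => `](- n%:R), +oo[%classic) _ _ _ _ m1 m2) => //.
- exact: RGenOInfty.measurableE.
- move=> _ _ [x ->] [y ->]; exists (Num.max x y).
  by apply/seteqP; split => z /=; rewrite !in_itv/= !andbT gt_max => /andP.
- by move=> n; exists (- n%:R).
- apply/seteqP; split => // x _; exists (Num.bound `|x|) => //=.
  rewrite in_itv/= andbT ltrNl (le_lt_trans _ (archi_boundP (normr_ge0 x)))//.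
  by rewrite -normrN ler_norm.
- by move=> _ [c ->]; exact: tailE.
- by move=> n; rewrite (le_lt_trans (probability_le1 _ _)) ?ltry.
Qed.

Theorem theorem13 (R : realType) (a b : R) (ha : 0 < a) (hb : 0 < b) :
  (forall (d : measure_display) (T : measurableType d) (P : probability T R)
          (H : R -> {RV P >-> R}),
     subordinator H -> laplace_exponent H (gamma_exponent a b) ->
     forall t : R, 0 < t -> has_density (H t) (gamma_density a b t)) /\
  (forall x lam : R, 0 < x -> 0 < lam ->
     (\int[lebesgue_measure]_(t in `]0%R, +oo[)
        (expR (- (lam * t)) * gamma_density a b t x)%:E)%E =
     (expR (- (b * x)) * (b / a) * expR (- (lam / a))
        * nu (b * x * expR (- (lam / a))) (-1))%:E).
Proof.
split.
  by move=> d T P H subH laplaceH; exact: gamma_subordinator_density.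
by move=> x lam x0 _; exact: laplace_time_gamma_density.
Qed.
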